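(* Let $m,n$ be positive integers and let $\mathbf{A}$ be an $m\times n$ random subgaussian matrix, i.e. either a random Gaussian matrix or a random Rademacher matrix. Let $\mathbf{W}\in\mathbb{R}^{n\times n}$ be a (possibly random) symmetric matrix with all eigenvalues in $[0,1]$ that is statistically independent of $\mathbf{A}$, let $r=\operatorname{rank}(\mathbf{W})$, and let $\boldsymbol{\xi}\in\mathbb{R}^n$ be a fixed vector with $\boldsymbol{\xi}\in\mathcal{R}(\mathbf{W})$. For $\beta\in(0,1)$, suppose $$m\geqslant\frac{\ln(2/\beta)+r\ln(12/0.99)}{\gamma(0.99/2)},$$ where $\gamma(t)=t^2/6$ if $\mathbf{A}$ is Gaussian and $\gamma(t)=t^2/4-t^3/6$ if $\mathbf{A}$ is Rademacher. Then with probability at least $1-\beta$, $\boldsymbol{\xi}$ is the unique minimizer of the optimization problem $$\text{minimize } \ \boldsymbol{x}^\top(\mathbf{I}-\mathbf{W})\mathbf{W}^\dagger\boldsymbol{x}\quad\text{subject to}\quad \mathbf{A}\boldsymbol{x}=\mathbf{A}\boldsymbol{\xi},\ \ \boldsymbol{x}\in\mathcal{R}(\mathbf{W}).$$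
   Context: A random Gaussian matrix is an $m\times n$ matrix whose entries are i.i.d. Gaussian with mean $0$ and variance $1/m$. A random Rademacher matrix is an $m\times n$ matrix whose entries are i.i.d., each equal to $1/\sqrt{m}$ or $-1/\sqrt{m}$ with probability $1/2$ each. $\mathcal{R}(\cdot)$ denotes range, $\mathbf{W}^\dagger$ is the Moore–Penrose pseudoinverse, and $\mathbf{I}$ is the $n\times n$ identity. The matrix $\mathbf{W}$ may be deterministic; if it is random, the stated conditions on $\mathbf{W}$ (and on its rank) are assumed to hold almost surely. *)

(* Defs.v *)
From HB Require Import structures.
From mathcomp Require Import all_boot all_order all_algebra.
From mathcomp Require Import all_classical all_reals all_analysis.

Set Implicit Arguments.
Unset Strict Implicit.
Unset Printing Implicit Defensive.

Import Order.TTheory GRing.Theory Num.Theory.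
Import numFieldNormedType.Exports.

Local Open Scope classical_set_scope.
Local Open Scope ring_scope.

(* The product (Borel) sigma-algebra on matrices, generated by the entries, so
   that a random matrix is a random variable with values in 'M[R]_(m, n). *)
Section matrix_sigma_algebra.
Context {R : realType} {m n : nat}.

Definition matrix_measurable : set (set 'M[R]_(m, n)) :=
  <<s \bigcup_(ij in [set: 'I_m * 'I_n])
        preimage_set_system setT (fun M : 'M[R]_(m, n) => M ij.1 ij.2)
          measurable >>.

Let matrix_measurable0 : matrix_measurable set0.
Proof. exact: sigma_algebra0. Qed.

Let matrix_measurableC A : matrix_measurable A -> matrix_measurable (~` A).
Proof. exact: sigma_algebraC. Qed.

Let matrix_measurable_bigcup (F : (set 'M[R]_(m, n))^nat) :
  (forall i, matrix_measurable (F i)) -> matrix_measurable (\bigcup_i F i).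
Proof. exact: sigma_algebra_bigcup. Qed.

Definition matrix_display : measure_display.
Proof. exact: default_measure_display. Qed.

HB.instance Definition _ :=
  @isMeasurable.Build matrix_display 'M[R]_(m, n) matrix_measurable
    matrix_measurable0 matrix_measurableC matrix_measurable_bigcup.

Lemma measurable_entry (i : 'I_m) (j : 'I_n) :
  measurable_fun [set: 'M[R]_(m, n)] (fun M : 'M[R]_(m, n) => M i j).
Proof.
move=> _ B mB; apply: sub_sigma_algebra; exists (i, j) => //.
by exists B.
Qed.

Lemma measurable_matrix d (T : measurableType d) (X : T -> 'M[R]_(m, n)) :
  (forall i j, measurable_fun setT (fun w => X w i j)) -> measurable_fun setT X.
Proof.
move=> mX; apply: measurability (erefl : measurable = matrix_measurable) _.
move=> _ [_ [[i j] _ [B mB <-]] <-].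
by rewrite !setTI; have := mX i j measurableT B mB; rewrite setTI.
Qed.

End matrix_sigma_algebra.

Section probability.
Context {d : measure_display} {T : measurableType d} {R : realType}.
Variable P : probability T R.

Definition mutually_independent (I : finType) (X : I -> T -> R) : Prop :=
  forall (J : {set I}) (B : I -> set R), (forall i, measurable (B i)) ->
    P (\bigcap_(i in [set` J]) (X i @^-1` B i)) =
    (\prod_(i in J) P (X i @^-1` B i))%E.

Definition independent_rv d1 d2 (T1 : measurableType d1)
    (T2 : measurableType d2) (X : T -> T1) (Y : T -> T2) : Prop :=
  forall (B : set T1) (C : set T2), measurable B -> measurable C ->
    P (X @^-1` B `&` Y @^-1` C) = (P (X @^-1` B) * P (Y @^-1` C))%E.

(* Inner probability of Q, which is P Q when Q is measurable; P carries no
   information on a set that is not. *)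
Definition with_probability_at_least (p : R) (Q : set T) : Prop :=
  exists E : set T, [/\ measurable E, E `<=` Q & (p%:E <= P E)%E].

End probability.

Variant subgaussian_kind := Gaussian | Rademacher.

Section subgaussian.
Context {R : realType}.

Definition subgaussian_gamma (k : subgaussian_kind) (t : R) : R :=
  match k with
  | Gaussian => t ^+ 2 / 6
  | Rademacher => t ^+ 2 / 4 - t ^+ 3 / 6
  end.

Context {d : measure_display} {T : measurableType d}.
Variable P : probability T R.

(* The second argument of normal_prob is the standard deviation. *)
Definition entry_law (k : subgaussian_kind) (m : nat) (X : T -> R) : Prop :=
  match k with
  | Gaussian => forall B : set R, measurable B ->
      P (X @^-1` B) = normal_prob 0 (Num.sqrt m%:R^-1) B
  | Rademacher =>
      P (X @^-1` [set (Num.sqrt m%:R)^-1]) = (2^-1)%:E /\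
      P (X @^-1` [set - (Num.sqrt m%:R)^-1]) = (2^-1)%:E
  end.

Definition subgaussian_matrix (k : subgaussian_kind) (m n : nat)
    (A : {RV P >-> 'M[R]_(m, n)}) : Prop :=
  mutually_independent P (fun (ij : 'I_m * 'I_n) w => A w ij.1 ij.2) /\
  forall i j, entry_law k m (fun w => A w i j).

End subgaussian.

Section linear_algebra.
Context {R : realType}.

(* The column space; MathComp's %MS notions are about row spaces. *)
Definition mxrange {m n : nat} (M : 'M[R]_(m, n)) : set 'cV[R]_m :=
  range (fun y : 'cV[R]_n => M *m y).

Definition symmetric_mx {n : nat} (M : 'M[R]_n) : Prop := M^T = M.

Definition is_pseudoinverse {m n : nat} (M : 'M[R]_(m, n)) (X : 'M[R]_(n, m))
    : Prop :=
  [/\ M *m X *m M = M, X *m M *m X = X,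
      (M *m X)^T = M *m X & (X *m M)^T = X *m M].

(* Moore-Penrose; unrelated to MathComp's pinvmx, which is only a partial
   inverse. The default value 0 is never used: see pseudoinverseP. *)
Definition pseudoinverse {m n : nat} (M : 'M[R]_(m, n)) : 'M[R]_(n, m) :=
  xget 0 [set X | is_pseudoinverse M X].

Lemma is_pseudoinverse_unique m n (M : 'M[R]_(m, n)) (X Y : 'M[R]_(n, m)) :
  is_pseudoinverse M X -> is_pseudoinverse M Y -> X = Y.
Proof.
move=> [MX XM sMX sXM] [MY YM sMY sYM].
have eMXY : M *m X = M *m Y.
  rewrite -sMX -[in LHS]MY -(mulmxA (M *m Y)) trmx_mul sMX sMY.
  by rewrite mulmxA MX.
have eXMY : X *m M = Y *m M.
  rewrite -sXM -[in LHS]MY -(mulmxA M) mulmxA trmx_mul sXM sYM.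
  by rewrite -!mulmxA (mulmxA M X) MX.
by rewrite -XM -YM eXMY -!mulmxA eMXY.
Qed.

Lemma gram_unitmx r n (F : 'M[R]_(r, n)) :
  row_free F -> F *m F^T \in unitmx.
Proof.
move=> Ffree; rewrite -row_free_unit -kermx_eq0; apply/eqP/row_matrixP => i.
rewrite row0; set v := row i _.
have vFF : v *m (F *m F^T) = 0.
  by apply/sub_kermxP; rewrite /v row_sub.
suff vF : v *m F = 0.
  by apply/eqP; rewrite -(mulmx_free_eq0 _ Ffree) vF.
have nrm0 : \sum_j ((v *m F) ord0 j) ^+ 2 = 0.
  have : ((v *m F) *m (v *m F)^T) ord0 ord0 = 0.
    by rewrite trmx_mul mulmxA -(mulmxA v) vFF mul0mx mxE.
  rewrite mxE => vv0; rewrite -[RHS]vv0; apply: eq_bigr => j _.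
  by rewrite expr2 [(v *m F)^T j _]mxE.
apply/rowP => j; rewrite [RHS]mxE; apply/eqP; rewrite -sqrf_eq0; apply/eqP.
by apply: (psumr_eq0P _ nrm0) => // k _; exact: sqr_ge0.
Qed.

Lemma pseudoinverse_exists m n (M : 'M[R]_(m, n)) :
  exists X, is_pseudoinverse M X.
Proof.
suff factor r (C : 'M[R]_(m, r)) (F : 'M[R]_(r, n)) :
    row_full C -> row_free F -> exists X, is_pseudoinverse (C *m F) X.
  rewrite -(mulmx_base M).
  by apply: factor; [exact: col_base_full|exact: row_base_free].
move=> Cfull Ffree.
have uF : F *m F^T \in unitmx by exact: gram_unitmx.
have uC : C^T *m C \in unitmx.
  rewrite -[X in _ *m X]trmxK; apply: gram_unitmx.
  by rewrite /row_free mxrank_tr.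
pose G := invmx (F *m F^T); pose H := invmx (C^T *m C).
have GT : G^T = G by rewrite /G trmx_inv trmx_mul trmxK.
have HT : H^T = H by rewrite /H trmx_inv trmx_mul trmxK.
have FX : F *m (F^T *m G) = 1%:M by rewrite mulmxA mulmxV.
have HC : (H *m C^T) *m C = 1%:M by rewrite -mulmxA mulVmx.
have MX : (C *m F) *m (F^T *m G *m (H *m C^T)) = C *m (H *m C^T).
  by rewrite -mulmxA (mulmxA F) FX mul1mx.
have XM : (F^T *m G *m (H *m C^T)) *m (C *m F) = (F^T *m G) *m F.
  by rewrite -mulmxA (mulmxA (H *m C^T)) HC mul1mx.
exists (F^T *m G *m (H *m C^T)); split.
- by rewrite MX -(mulmxA C) (mulmxA (H *m C^T)) HC mul1mx.
- by rewrite XM -(mulmxA _ F) (mulmxA F) FX mul1mx.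
- by rewrite MX !trmx_mul trmxK HT mulmxA.
- by rewrite XM !trmx_mul trmxK GT mulmxA.
Qed.

Lemma pseudoinverseP m n (M : 'M[R]_(m, n)) :
  is_pseudoinverse M (pseudoinverse M).
Proof.
rewrite /pseudoinverse; have [X MX] := pseudoinverse_exists M.
by case: xgetP => [//|/(_ X)]; apply.
Qed.

Definition unique_minimizer {n : nat} (f : 'cV[R]_n -> R) (S : set 'cV[R]_n)
    (x : 'cV[R]_n) : Prop :=
  S x /\ forall y, S y -> y <> x -> f x < f y.

Definition objective {n : nat} (W : 'M[R]_n) (x : 'cV[R]_n) : R :=
  (x^T *m (1%:M - W) *m pseudoinverse W *m x) 0 0.

Definition feasible {m n : nat} (A : 'M[R]_(m, n)) (W : 'M[R]_n)
    (xi : 'cV[R]_n) : set 'cV[R]_n :=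
  [set x | A *m x = A *m xi /\ mxrange W x].

End linear_algebra.

(* Main.v *)
(** It suffices that [A] is injective on the range of [W]: then the only
    feasible point is [xi], whatever the objective.  All that is used of the
    law of [A] is that its entries are independent and that no entry takes a
    given value with probability more than 1/2.

    Fix [W], of rank [r]; Fubini's theorem for the independent pair (W, A)
    reduces the random case to this one.  If [A *m W] has rank less than [r],
    some set [J] of fewer than [r] rows of [A] already spans the rows of
    [A *m W].  Given these rows there is [x <> 0] in the range of [W] that they
    annihilate, and then the other rows must annihilate [x] too.  As [x] has a
    nonzero coordinate [j0], this forces each entry of column [j0] outside [J]
    to a prescribed value, which has probability at most 2^-(m - #|J|).  For
    0 < s <= 1, summing over [J] with weights s^(#|J| - r) >= 1 bounds the
    failure probability by s^-r (s + 1/2)^m, and s = 0.99/12 makes this at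
    most [beta]. *)
From HB Require Import structures.
Require Import Defs.
From mathcomp Require Import all_boot all_order all_algebra.
From mathcomp Require Import all_classical all_reals all_analysis.
From mathcomp Require Import measurable_realfun lra.

Import Order.TTheory GRing.Theory Num.Theory.
Import numFieldNormedType.Exports.

Local Open Scope classical_set_scope.
Local Open Scope ring_scope.

(** * Rank of a product in terms of rows, kernels and minors *)

Section linear_algebra.
Context {F : fieldType}.

(** Rows outside [J] are zeroed rather than deleted, so that the type does not depend on [#|J|]. *)
Definition rowmask {m n} (J : {set 'I_m}) (M : 'M[F]_(m, n)) : 'M[F]_(m, n) :=
  \matrix_(i, j) if i \in J then M i j else 0.

Lemma rowmask_mul m n p J (M : 'M[F]_(m, n)) (W : 'M[F]_(n, p)) :
  rowmask J (M *m W) = rowmask J M *m W.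
Proof.
apply/matrixP => i j; rewrite !mxE.
case: ifPn => iJ; first by apply: eq_bigr => k _; rewrite mxE iJ.
by rewrite big1// => k _; rewrite mxE (negbTE iJ) mul0r.
Qed.

Lemma rowmask_sub m n J (M : 'M[F]_(m, n)) : (rowmask J M <= M)%MS.
Proof.
by rewrite -[X in rowmask _ X]mul1mx rowmask_mul submxMl.
Qed.

(** [J] indexes a basis of the row space chosen among the rows, as given by [maxrankfun]. *)
Lemma rowmask_rank m n (M : 'M[F]_(m, n)) : exists J : {set 'I_m},
  #|J| = \rank M /\ \rank (rowmask J M) = \rank M.
Proof.
exists (maxrankfun M @: 'I_(\rank M)); split.
  by rewrite card_imset ?card_ord//; exact: maxrankfun_inj.
apply/eqP; rewrite eqn_leq mxrankS ?rowmask_sub//=.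
rewrite -[X in (X <= _)%N](eq_maxrowsub M) mxrankS//.
suff -> : rowsub (maxrankfun M) M =
    rowsub (maxrankfun M) (rowmask (maxrankfun M @: 'I_(\rank M)) M).
  by rewrite [X in (X <= _)%MS]rowsubE submxMl.
by apply/matrixP => i j; rewrite !mxE imset_f.
Qed.

(** Rank-nullity: passing from [W] to [A *m W] costs exactly the dimension of the intersection of
    the column space of [W] with the kernel of [A]. Transposing turns this into [mxrank_injP]. *)
Lemma mulmx_rank_injP m n p (A : 'M[F]_(m, n)) (W : 'M[F]_(n, p)) :
  (forall u : 'cV_p, A *m (W *m u) = 0 -> W *m u = 0) <->
  \rank (A *m W) = \rank W.
Proof.
rewrite -mxrank_tr -(mxrank_tr W) trmx_mul.
split=> [AW0|/(mxrank_injP m) /eqP WA u AWu].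
  apply/(mxrank_injP m); rewrite -nz_row_eq0; set v := nz_row _.
  have : (v <= W^T :&: kermx A^T)%MS by exact: nz_row_sub.
  rewrite sub_capmx => /andP[/submxP[u vu] /sub_kermxP vA].
  have vE : v = (W *m u^T)^T by rewrite trmx_mul trmxK.
  by rewrite vE AW0 ?trmx0// -[LHS]trmxK trmx_mul -vE vA trmx0.
apply: trmx_inj; rewrite trmx0; apply/eqP; rewrite -submx0 -WA sub_capmx.
rewrite {1}trmx_mul submxMl; apply/sub_kermxP.
by rewrite -trmx_mul AWu trmx0.
Qed.

(** Select [k] independent rows, then [k] independent columns of what they form. Index maps need not
    be injective, since a repeated index only gives a zero determinant; as finite functions they
    range over a finite type. *)
Lemma rank_minorP m n k (M : 'M[F]_(m, n)) :
  reflect (exists fg : {ffun 'I_k -> 'I_m} * {ffun 'I_k -> 'I_n},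
             \det (mxsub fg.1 fg.2 M) != 0)
          (k <= \rank M)%N.
Proof.
apply: (iffP idP) => [kM|[[f g]]]; last first.
  rewrite -unitfE -unitmxE => /mxrank_unit/= <-.
  have -> : mxsub f g M = rowsub f 1%:M *m M *m colsub g 1%:M.
    by rewrite -rowsubE mulmx_colsub mulmx1 -mxsubcr.
  by rewrite (leq_trans (mxrankM_maxl _ _))// mxrankM_maxr.
pose h (i : 'I_k) := widen_ord kM i.
have h_inj : injective h by move=> i j /(congr1 val)/= /val_inj.
pose N := rowsub h (rowsub (maxrankfun M) M).
have Nk : \rank N = k.
  rewrite /N rowsubE mxrankMfree ?maxrowsub_free//.
  apply/eqP; rewrite -[_ == _]/(row_free _); apply/row_freeP.
  exists (rowsub h 1%:M)^T; apply/matrixP => i j; rewrite !mxE.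
  rewrite (bigD1 (h i))//= !mxE eqxx mul1r big1 ?addr0 => [|l].
    by rewrite inj_eq// eq_sym.
  by rewrite eq_sym !mxE => /negbTE ->; rewrite mul0r.
have Nfull : row_full N^T by rewrite /row_full mxrank_tr Nk.
exists ([ffun i => maxrankfun M (h i)], [ffun i => fullrankfun Nfull i]).
rewrite -unitfE -unitmxE -unitmx_tr -row_free_unit /=.
suff -> : (mxsub [ffun i => maxrankfun M (h i)] [ffun i => fullrankfun Nfull i]
   M)^T = rowsub (fullrankfun Nfull) N^T by exact: fullrowsub_free.
by apply/matrixP => i j; rewrite !mxE !ffunE.
Qed.

End linear_algebra.

(** * Measurability of matrix operations, and uniqueness of laws on matrices *)

Section matrix_measurability.
Context {R : realType}.

(** Minors are polynomials in the entries, and by [rank_minorP] a lower bound on the rank says that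
    one of finitely many minors is nonzero. Level sets of the rank are differences of such
    events. *)
Lemma measurable_rank m n : measurable_fun setT (fun M : 'M[R]_(m, n) => \rank M).
Proof.
have mge k : measurable [set M : 'M[R]_(m, n) | (k <= \rank M)%N].
  rewrite (_ : mkset _ = \bigcup_(fg in
      [set: {ffun 'I_k -> 'I_m} * {ffun 'I_k -> 'I_n}])
      ((fun M : 'M[R]_(m, n) => \det (mxsub fg.1 fg.2 M)) @^-1` ~` [set 0])).
    apply: fin_bigcup_measurable => [|[f g] _]; first exact: finite_finset.
    rewrite -[X in measurable X]setTI.
    suff mdet : measurable_fun setT
        (fun M : 'M[R]_(m, n) => \det (mxsub f g M)).
      by apply: mdet => //; apply: measurableC; exact: measurable_set1.
    have mentry i j : measurable_fun setT (fun M : 'M[R]_(m, n) => mxsub f g M i j).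
      rewrite [X in measurable_fun _ X](_ : _ = (fun M : 'M[R]_(m, n) => M (f i) (g j))).
        exact: measurable_entry.
      by apply/funext => M; rewrite mxE.
    apply: measurable_sum => s; apply: measurable_funM; first exact: measurable_cst.
    by apply: measurable_prod => i _; exact: mentry.
  apply/seteqP; split => M /=.
    by move=> /rank_minorP[fg fgM]; exists fg => //=; exact/eqP.
  by move=> [fg _ /= /eqP fgM]; apply/rank_minorP; exists fg.
move=> _ Y _; rewrite setTI.
rewrite (_ : _ @^-1` Y = \bigcup_(k in Y)
    ([set M : 'M[R]_(m, n) | (k <= \rank M)%N] `\`
     [set M : 'M[R]_(m, n) | (k.+1 <= \rank M)%N])).
  by apply: bigcup_measurable => k _; exact: measurableD.
apply/seteqP; split => M /=.
  by move=> YM; exists (\rank M) => //=; split => //; rewrite ltnn.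
move=> [k Yk [/= kM /negP]]; rewrite -leqNgt => Mk.
by rewrite (_ : \rank M = k)//; apply/eqP; rewrite eqn_leq Mk.
Qed.

Lemma measurable_mulmx d (T : measurableType d) m n p
    (X : T -> 'M[R]_(m, n)) (Y : T -> 'M[R]_(n, p)) :
  measurable_fun setT X -> measurable_fun setT Y ->
  measurable_fun setT (fun w => X w *m Y w).
Proof.
move=> mX mY; apply: measurable_matrix => i j.
rewrite [X in measurable_fun _ X](_ : _ = fun w => \sum_k X w i k * Y w k j); last first.
  by apply/funext => M; rewrite mxE.
apply: measurable_sum => k; apply: measurable_funM.
- exact: (measurableT_comp (measurable_entry i k)).
- exact: (measurableT_comp (measurable_entry k j)).
Qed.

Definition mix {m n} (K : pred ('I_m * 'I_n))
    (MN : 'M[R]_(m, n) * 'M[R]_(m, n)) : 'M[R]_(m, n) :=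
  \matrix_(i, j) if K (i, j) then MN.1 i j else MN.2 i j.

Lemma measurable_mix m n (K : pred ('I_m * 'I_n)) : measurable_fun setT (mix K).
Proof.
apply: measurable_matrix => i j.
rewrite [X in measurable_fun _ X](_ : _ = fun MN : 'M[R]_(m, n) * 'M[R]_(m, n) =>
    if K (i, j) then MN.1 i j else MN.2 i j); last first.
  by apply/funext => M; rewrite mxE.
case: (K (i, j)).
- exact: (measurableT_comp (measurable_entry i j) measurable_fst).
- exact: (measurableT_comp (measurable_entry i j) measurable_snd).
Qed.

Lemma measurable_rowmask m n (J : {set 'I_m}) :
  measurable_fun setT (@rowmask R m n J).
Proof.
apply: measurable_matrix => i j.
rewrite [X in measurable_fun _ X](_ : _ =
    fun M : 'M[R]_(m, n) => if i \in J then M i j else 0); last first.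
  by apply/funext => M; rewrite mxE.
by case: (i \in J); [exact: measurable_entry|exact: measurable_cst].
Qed.

Definition box {m n} (B : 'I_m * 'I_n -> set R) : set 'M[R]_(m, n) :=
  \bigcap_ij ((fun M : 'M[R]_(m, n) => M ij.1 ij.2) @^-1` B ij).

Lemma measurable_box m n (B : 'I_m * 'I_n -> set R) :
  (forall ij, measurable (B ij)) -> measurable (box B).
Proof.
move=> mB; apply: fin_bigcap_measurable => [|ij _]; first exact: finite_finset.
by rewrite -[X in measurable X]setTI; exact: measurable_entry.
Qed.

(** Boxes are closed under intersection and generate the sigma-algebra, so the uniqueness theorem
    for measures on a pi-system applies. *)
Lemma box_measure_unique m n (m1 m2 : probability 'M[R]_(m, n) R) :
  (forall B, (forall ij, measurable (B ij)) -> m1 (box B) = m2 (box B)) ->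
  forall E, measurable E -> m1 E = m2 E.
Proof.
move=> m12.
pose G : set (set 'M[R]_(m, n)) :=
  [set A | exists2 B, (forall ij, measurable (B ij)) & A = box B].
have G_T : G setT.
  by exists (fun=> setT) => [_//|]; apply/seteqP; split.
apply: (measure_unique G (fun=> setT)).
- apply/seteqP; split => A.
    apply: smallest_sub; first exact: smallest_sigma_algebra.
    move=> _ [ij _ [B mB <-]]; apply: sub_sigma_algebra.
    (* A generator constrains a single entry: it is a box whose other sides are the whole line. *)
    exists (fun kl => if kl == ij then B else setT) => [kl|].
      by case: ifP.
    rewrite setTI; apply/seteqP; split => M /=.
      by move=> BM kl _ /=; case: eqVneq => // ->.
    by move=> /(_ ij I)/=; rewrite eqxx.
  apply: smallest_sub; first exact: sigma_algebra_measurable.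
  by move=> _ [B mB ->]; exact: measurable_box.
- move=> _ _ [B mB ->] [C mC ->]; exists (fun ij => B ij `&` C ij) => [ij|].
    exact: measurableI.
  rewrite /box -bigcapI; apply: eq_bigcapr => ij _.
  by rewrite preimage_setI.
- by [].
- by rewrite bigcup_const.
- by move=> _ [B mB ->]; exact: m12.
- by move=> _; rewrite (le_lt_trans (probability_le1 _ _)) ?ltry.
Qed.

End matrix_measurability.

(** * Fubini bounds for independent pairs, and the union bound *)

Section product_bounds.
Context {R : realType}.

Lemma product_measure1_le d1 d2 (T1 : measurableType d1) (T2 : measurableType d2)
    (m1 : probability T1 R) (m2 : probability T2 R) (E : set (T1 * T2)) (c : R) :
  measurable E -> (forall x, m2 (xsection E x) <= c%:E)%E ->
  ((m1 \x m2) E <= c%:E)%E.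
Proof.
move=> mE Ec; rewrite /product_measure1.
apply: (@le_trans _ _ (\int[m1]_x c%:E)%E); last first.
  by rewrite integral_cst//= probability_setT mule1.
apply: ge0_le_integral => //=.
exact: measurable_fun_xsection.
Qed.

(** By independence the law of the pair is the product of the two laws, so a bound uniform over the
    values of [X] passes to the joint event. *)
Lemma independent_rv_le d d1 d2 (T : measurableType d) (P : probability T R)
    (T1 : measurableType d1) (T2 : measurableType d2)
    (X : {RV P >-> T1}) (Y : {RV P >-> T2}) (E : set (T1 * T2)) (c : R) :
  independent_rv P Y X -> measurable E ->
  (forall x, distribution P Y (xsection E x) <= c%:E)%E ->
  (P ((fun w => (X w, Y w)) @^-1` E) <= c%:E)%E.
Proof.
move=> XY mE Ec.
have mXY : measurable_fun setT (fun w => (X w, Y w)) by exact: measurable_fun_pair.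
pose XYm := isMeasurableFun.Build _ _ _ _ _ mXY.
pose Z : {mfun T >-> (T1 * T2)%type} := HB.pack (fun w => (X w, Y w)) XYm.
rewrite -[X in (X <= _)%E]/(distribution P Z E).
rewrite -(@product_measure_unique _ _ _ _ _ (distribution P X) (distribution P Y)
  (distribution P Z)) //.
  exact: product_measure1_le.
move=> B C mB mC; rewrite muleC; apply: eq_trans (XY C B mC mB).
rewrite /distribution /pushforward; congr (P _).
by apply/seteqP; split => w [].
Qed.

Lemma bigsetU_measure_le d (T : measurableType d) (mu : probability T R)
    (I : finType) (Q : pred I) (F : I -> set T) :
  (forall i, measurable (F i)) ->
  (mu (\big[setU/set0]_(i | Q i) F i) <= \sum_(i | Q i) mu (F i))%E.
Proof.
move=> mF.
elim: (index_enum I) => [|i s IH]; first by rewrite !big_nil measure0.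
rewrite !big_cons; case: ifP => // _.
rewrite (le_trans (measureU2 _ _ _))//; first exact: bigsetU_measurable.
by rewrite leeD2l.
Qed.

End product_bounds.

(** * Conditioning on some of the entries of a matrix with independent entries *)

HB.instance Definition _ (R : realType) (m n : nat) (K : pred ('I_m * 'I_n)) :=
  isMeasurableFun.Build _ _ _ _ (mix (R := R) K) (measurable_mix m n K).

Section independent_entries.
Context {R : realType} {m n : nat}.
Variable mu : probability 'M[R]_(m, n) R.
Hypothesis mu_indep : mutually_independent mu
  (fun (ij : 'I_m * 'I_n) (M : 'M[R]_(m, n)) => M ij.1 ij.2).

Lemma box_measure (B : 'I_m * 'I_n -> set R) :
  (forall ij, measurable (B ij)) ->
  mu (box B) = (\prod_ij mu ((fun M : 'M[R]_(m, n) => M ij.1 ij.2) @^-1` B ij))%E.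
Proof.
move=> mB; have := mu_indep finset.setT B mB.
rewrite (_ : \bigcap_(ij in _) _ = box B) => [->|].
  by apply: eq_bigl => ij; rewrite inE.
by rewrite /box; congr (bigcap _ _); apply/seteqP; split => ij //= _.
Qed.

(* Resampling the entries outside [K] independently does not change the law, so
   that Fubini's theorem conditions on the entries in [K]. *)
Lemma mix_measure K E : measurable E -> mu E = (mu \x mu)%E (mix K @^-1` E).
Proof.
move=> mE.
rewrite -[RHS]/(distribution (mu \x mu)%E (mix K) E).
apply: box_measure_unique mE => B mB.
rewrite /distribution /pushforward /=.
(* The preimage of a box under [mix K] is a product of two boxes, each constraining only the entries
   taken from its factor; the sides left free contribute factors 1. *)
pose BK (b : bool) ij := if K ij == b then B ij else setT.
have mBK b ij : measurable (BK b ij) by rewrite /BK; case: ifP.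
have -> : mix K @^-1` box B = box (BK true) `*` box (BK false).
  apply/seteqP; split => [[M N]|[M N] [/= BM BN]] /=.
    move=> BMN; split=> -[i j] _ /=; have /= := BMN (i, j) I; rewrite mxE /BK/=;
      by case: (K (i, j)).
  move=> [i j] _ /=; have /= := BM (i, j) I; have /= := BN (i, j) I.
  by rewrite mxE /BK/=; case: (K (i, j)).
rewrite product_measure1E; [|exact: measurable_box..].
rewrite (box_measure _ mB) [X in (X * _)%E](box_measure _ (mBK true))
  [X in (_ * X)%E](box_measure _ (mBK false)).
rewrite -big_split/=; apply: eq_bigr => ij _.
rewrite /BK; case: (K ij) => /=; rewrite preimage_setT probability_setT.
  by rewrite mule1.
by rewrite mul1e.
Qed.

Lemma mix_measure_le K E (c : R) : measurable E ->
  (forall M, mu [set N | E (mix K (M, N))] <= c%:E)%E -> (mu E <= c%:E)%E.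
Proof.
move=> mE Ec; rewrite (mix_measure K)//; apply: product_measure1_le.
  by rewrite -[X in measurable X]setTI; exact: measurable_mix.
move=> M; apply: le_trans (Ec M); rewrite (_ : xsection _ _ = [set N | E (mix K (M, N))])//.
by apply/seteqP; split => N /=; rewrite /xsection/= inE.
Qed.

End independent_entries.

(** * Probability that a fixed matrix loses rank *)

Lemma measurable_rank_lt (R : realType) d (T : measurableType d) m n p q
    (X : T -> 'M[R]_(m, n)) (Y : T -> 'M[R]_(p, q)) :
  measurable_fun setT X -> measurable_fun setT Y ->
  measurable [set w | (\rank (X w) < \rank (Y w))%N].
Proof.
move=> mX mY.
have := @measurable_fun_ltn _ T setT (fun w => \rank (X w)) (fun w => \rank (Y w))
  (measurableT_comp (measurable_rank _ _) mX)
  (measurableT_comp (measurable_rank _ _) mY) measurableT [set true].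
by rewrite setTI; apply.
Qed.

Lemma prode_le_exp (R : realType) (I : finType) (J : {pred I}) (f : I -> \bar R)
    (c : R) : (forall i, 0 <= f i <= c%:E)%E ->
  (\prod_(i in J) f i <= (c ^+ #|J|)%:E)%E.
Proof.
move=> fc; rewrite -prodr_const.
suff /andP[] : (0 <= \prod_(i in J) f i <= (\prod_(i in J) c)%:E)%E by [].
elim/big_rec2 : _ => [|i b a _ /andP[a0 ab]]; first by rewrite lee01 lexx.
have /andP[f0 fi] := fc i; apply/andP; split; first exact: mule_ge0.
by rewrite EFinM; exact: lee_pmul.
Qed.

Section rank_drop.
Context {R : realType} {m n : nat}.
Variable mu : probability 'M[R]_(m, n) R.
Hypothesis mu_indep : mutually_independent mu
  (fun (ij : 'I_m * 'I_n) (M : 'M[R]_(m, n)) => M ij.1 ij.2).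
Hypothesis mu_atom : forall i j c, (mu [set M | M i j = c] <= (2^-1)%:E)%E.

Let measurable_ker (I0 : {set 'I_m}) (x : 'cV[R]_n) :
  measurable [set M : 'M[R]_(m, n) | forall i, i \in I0 -> (M *m x) i 0 = 0].
Proof.
rewrite (_ : mkset _ = \bigcap_(i in [set` I0])
    ((fun M : 'M[R]_(m, n) => (M *m x) i 0) @^-1` [set 0])).
  apply: fin_bigcap_measurable => [|i _]; first exact: finite_finset.
  rewrite -[X in measurable X]setTI.
  have mMx : measurable_fun setT (fun M : 'M[R]_(m, n) => M *m x).
    by apply: measurable_mulmx; [exact: measurable_id|exact: measurable_cst].
  have mMxi := measurableT_comp (measurable_entry i ord0) mMx.
  exact: mMxi.
by apply/seteqP; split.
Qed.

(** Condition on all columns except one, [j0], at which [x] is nonzero. Each equation then fixes one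
    entry of column [j0], and these entries are independent with atoms at most 1/2. *)
Lemma measure_ker_le (I0 : {set 'I_m}) (x : 'cV[R]_n) : x != 0 ->
  (mu [set M | forall i, i \in I0 -> (M *m x) i ord0 = 0%R] <= (2^-1 ^+ #|I0|)%:E)%E.
Proof.
move=> /cV0Pn[j0 xj0].
apply: (mix_measure_le mu mu_indep (fun ij => ij.2 != j0)) => // M.
(* The value forced on entry (i, j0) by the other entries of row i. *)
pose c i := - (\sum_(j | j != j0) M i j * x j 0) / x j0 0.
pose J : {set 'I_m * 'I_n} := (fun i => (i, j0)) @: I0.
have cardJ : #|J| = #|I0| by rewrite card_imset// => i k [].
rewrite (_ : mkset _ = \bigcap_(ij in [set` J])
    ((fun N : 'M[R]_(m, n) => N ij.1 ij.2) @^-1` [set c ij.1])); last first.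
  have mixE N i : (mix (fun ij => ij.2 != j0) (M, N) *m x) i 0 =
      N i j0 * x j0 0 + \sum_(j | j != j0) M i j * x j 0.
    rewrite mxE (bigD1 j0)//= mxE/= eqxx/=; congr (_ + _).
    by apply: eq_bigr => j jj0; rewrite mxE/= jj0.
  apply/seteqP; split => N /=.
    move=> N0 [i j] /= /imsetP[k kI0 [-> ->]]/=.
    have := N0 k kI0; rewrite mixE => /eqP; rewrite addr_eq0 => /eqP Nx.
    by rewrite /c -Nx mulfK.
  move=> N0 i iI0; have /= := N0 (i, j0) (imset_f _ iI0).
  by rewrite mixE => ->; rewrite /c divfK// addNr.
rewrite mu_indep// -cardJ; apply: prode_le_exp => ij.
by rewrite measure_ge0 mu_atom.
Qed.

Let measurable_rank_drop p (W : 'M[R]_(n, p)) (J : {set 'I_m}) :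
  measurable [set M : 'M[R]_(m, n) |
    (\rank (rowmask J M *m W) < \rank W)%N /\
    (\rank (M *m W) <= \rank (rowmask J M *m W))%N].
Proof.
have mW : measurable_fun setT (fun M : 'M[R]_(m, n) => M *m W).
  by apply: measurable_mulmx; [exact: measurable_id|exact: measurable_cst].
have mJW : measurable_fun setT (fun M : 'M[R]_(m, n) => rowmask J M *m W).
  by apply: measurable_mulmx; [exact: measurable_rowmask|exact: measurable_cst].
rewrite (_ : mkset _ =
  [set M : 'M[R]_(m, n) | (\rank (rowmask J M *m W) < \rank W)%N] `&`
  ~` [set M : 'M[R]_(m, n) | (\rank (rowmask J M *m W) < \rank (M *m W))%N]).
  apply: measurableI; last by apply: measurableC; exact: measurable_rank_lt.
  have mcW : measurable_fun setT (fun _ : 'M[R]_(m, n) => W).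
    exact: measurable_cst.
  exact: (measurable_rank_lt _ _ _ _ _ _ _ _ _ mJW mcW).
apply/seteqP; split => M /= [-> MJM]; split => //.
  by apply/negP; rewrite -leqNgt.
by rewrite leqNgt; exact/negP.
Qed.

(** Conditioning on the rows in [J] makes the masked product constant, so that [W *m u] below can be
    chosen before the other rows are drawn; [measure_ker_le] then applies to those rows. *)
Lemma rank_drop_measure_le p (W : 'M[R]_(n, p)) (J : {set 'I_m}) :
  (mu [set M | (\rank (rowmask J M *m W) < \rank W)%N /\
               (\rank (M *m W) <= \rank (rowmask J M *m W))%N]
   <= (2^-1 ^+ #|~: J|)%:E)%E.
Proof.
have mE := measurable_rank_drop p W J.
apply: (mix_measure_le mu mu_indep (fun ij => ij.1 \in J)) => // M.
have maskE N : rowmask J (mix (fun ij => ij.1 \in J) (M, N)) = rowmask J M.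
  by apply/matrixP => i j; rewrite !mxE; case: ifP => //= ->.
have [JMW|JMW] := ltnP (\rank (rowmask J M *m W)) (\rank W); last first.
  rewrite (_ : mkset _ = set0) ?measure0//.
  by apply/seteqP; split => // N /=; rewrite maskE ltnNge JMW => -[].
have [u [JMWu Wu]] : exists u : 'cV_p, rowmask J M *m (W *m u) = 0 /\ W *m u != 0.
  apply: contrapT => /forallNP uP; suff : \rank (rowmask J M *m W) = \rank W.
    by move=> e; rewrite e ltnn in JMW.
  apply/mulmx_rank_injP => u JMWu; apply/eqP; apply: contrapT => /negP Wu.
  by apply: (uP u).
apply: le_trans (measure_ker_le (~: J)%SET _ Wu).
have mN : measurable_fun setT (fun N : 'M[R]_(m, n) => mix (fun ij => ij.1 \in J) (M, N)).
  apply: (measurableT_comp (measurable_mix _ _ _)).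
  by apply: measurable_fun_pair; [exact: measurable_cst|exact: measurable_id].
apply: le_measure; rewrite ?inE.
- by rewrite -[X in measurable X]setTI; exact: mN.
- exact: measurable_ker.
move=> N /=; rewrite maskE => -[_ rk] i iJ.
set X := mix _ _ in rk *.
have sub : (rowmask J M *m W <= X *m W)%MS.
  by rewrite -(maskE N) -rowmask_mul rowmask_sub.
(* The row space of the masked product is contained in that of [X *m W] and has at least its rank,
   so the two agree: what the rows in [J] annihilate, all rows annihilate. *)
have /submxP[C XC] : (X *m W <= rowmask J M *m W)%MS.
  by rewrite -(mxrank_leqif_sup sub) eqn_leq rk mxrankS.
have : X *m (W *m u) = 0 by rewrite mulmxA XC -!mulmxA JMWu mulmx0.
move=> /matrixP/(_ i 0); rewrite [RHS]mxE => <-.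
rewrite !mxE; apply: eq_bigr => j _; congr (_ * _); rewrite mxE/=.
by move: iJ; rewrite finset.in_setC => /negbTE ->.
Qed.

Lemma rank_mul_measure_le p (W : 'M[R]_(n, p)) (s : R) : 0 < s <= 1 ->
  (mu [set M | (\rank (M *m W) < \rank W)%N]
   <= (s ^- (\rank W) * (s + 2^-1) ^+ m)%:E)%E.
Proof.
move=> /andP[s0 s1].
pose r := \rank W.
pose E J := [set M : 'M[R]_(m, n) | (\rank (rowmask J M *m W) < r)%N /\
               (\rank (M *m W) <= \rank (rowmask J M *m W))%N].
(* [rowmask_rank] supplies a [J] whose size is the rank of [M *m W], hence less than [r]. *)
have cover : [set M : 'M[R]_(m, n) | (\rank (M *m W) < r)%N] `<=`
    \big[setU/set0]_(J : {set 'I_m} | (#|J| < r)%N) E J.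
  move=> M /= Mr; have [J [cJ rJ]] := rowmask_rank m p (M *m W).
  rewrite (bigD1 J) ?cJ//=; left.
  by rewrite /E /= -rowmask_mul rJ.
have mE J : measurable (E J) by exact: measurable_rank_drop.
have mlt : measurable [set M : 'M[R]_(m, n) | (\rank (M *m W) < r)%N].
  have mcW : measurable_fun setT (fun _ : 'M[R]_(m, n) => W).
    exact: measurable_cst.
  apply: (measurable_rank_lt _ _ _ _ _ _ _ _ _ _ mcW).
  by apply: measurable_mulmx; [exact: measurable_id|exact: mcW].
apply: (@le_trans _ _ (mu (\big[setU/set0]_(J : {set 'I_m} | (#|J| < r)%N) E J))).
  by apply: le_measure; rewrite ?inE//; exact: bigsetU_measurable.
apply: le_trans (bigsetU_measure_le _ _ _ _ _ _ mE) _.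
apply: (@le_trans _ _ (\sum_(J : {set 'I_m} | (#|J| < r)%N) (2^-1 ^+ #|~: J|)%:E)%E).
  by apply: lee_sum => J _; exact: rank_drop_measure_le.
rewrite sumEFin lee_fin.
(* Expanding the power over subsets gives the term of [J] as [s ^+ #|J|] times the bound for
   [E J]. *)
have -> : (s + 2^-1) ^+ m =
    \sum_(J in {set 'I_m}) \prod_i (if i \in J then s else 2^-1).
  by rewrite -bigA_distr prodr_const card_ord.
rewrite mulr_sumr [leRHS](bigID (fun J : {set 'I_m} => (#|J| < r)%N))/=.
rewrite -[leLHS]addr0 lerD//.
  apply: ler_sum => J Jr.
  rewrite (eq_card (B := [predC J])) => [|i]; last by rewrite finset.in_setC.
  rewrite (bigID (mem J))/= (eq_bigr (fun=> s)) => [|i ->//].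
  rewrite [X in _ * (_ * X)](eq_bigr (fun=> 2^-1)) => [|i /negbTE ->//].
  (* The extra weight [s ^- r * s ^+ #|J|] is at least 1, because [#|J| < r] and [s <= 1]. *)
  rewrite !prodr_const mulrA ler_peMl ?exprn_ge0 ?invr_ge0//.
  rewrite mulrC ler_pdivlMr ?exprn_gt0// mul1r.
  by apply: ler_wiXn2l => //; [exact: ltW|exact: ltnW].
apply: sumr_ge0 => J _; rewrite mulr_ge0 ?invr_ge0 ?exprn_ge0 ?(ltW s0)//.
by apply: prodr_ge0 => i _; case: ifP => // _; rewrite (ltW s0).
Qed.

End rank_drop.

(** * Atoms of the entry laws, and the numerical estimate *)

Lemma entry_law_atom_le (R : realType) d (T : measurableType d)
    (P : probability T R) (k : subgaussian_kind) (m : nat) (X : T -> R) (c : R) :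
  (0 < m)%N -> measurable_fun setT X -> entry_law P k m X ->
  (P (X @^-1` [set c]) <= (2^-1)%:E)%E.
Proof.
move=> m0 mX; case: k => /= [-> //|[Pp Pn]].
  (* A normal law is absolutely continuous with respect to Lebesgue measure, so points are null. *)
  have := @normal_prob_dominates R 0 (Num.sqrt m%:R^-1).
  move=> /null_content_dominatesP /(_ [set c] (measurable_set1 c)).
  by move=> ->; [rewrite lee_fin invr_ge0|exact: lebesgue_measure_set1].
have mX1 a : measurable (X @^-1` [set a]).
  by rewrite -[X in measurable X]setTI; exact: mX.
set a := (Num.sqrt m%:R)^-1 in Pp Pn.
(* Positivity makes [a] and [- a] distinct; they then carry the whole mass, which leaves none for a
   third value. *)
have a0 : 0 < a by rewrite invr_gt0 sqrtr_gt0 ltr0n.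
have [->|ca] := eqVneq c a; first by rewrite Pp.
have [->|cNa] := eqVneq c (- a); first by rewrite Pn.
have disj (u v : R) : u != v -> X @^-1` [set u] `&` X @^-1` [set v] = set0.
  move=> /eqP uv; apply/seteqP; split => // w [Xu Xv];
    exact: uv (etrans (esym Xu) Xv).
have PaNa : P (X @^-1` [set a] `|` X @^-1` [set - a]) = 1%E.
  rewrite measureU//; last by apply: disj; apply/eqP; lra.
  by rewrite [X in (X + _)%E]Pp [X in (_ + X)%E]Pn -EFinD; congr EFin; lra.
have : (P (X @^-1` [set c]) + 1 <= 1)%E.
  rewrite -{1}PaNa -measureU//; last 2 first.
  - exact: measurableU.
  - by rewrite setIUr !disj// setU0.
  by apply: probability_le1; apply: measurableU => //; exact: measurableU.
rewrite -leeBrDr// subee// => /le_trans; apply.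
by rewrite lee_fin invr_ge0.
Qed.

(** Both values are near 0.041. Positivity serves to clear the denominator in the sample size; the
    upper bound, far from tight, gives [s + 1/2 <= 1 - g] in [sample_size_bound]. *)
Lemma subgaussian_gamma_bound (R : realType) (k : subgaussian_kind) :
  0 < subgaussian_gamma k (99 / 100 / 2 : R) <= 5 / 100.
Proof. by case: k; rewrite /subgaussian_gamma; apply/andP; split; lra. Qed.

(** With [s = 0.99/12] and [g] the value of gamma, the hypothesis exponentiates to
    [(2 / beta) * s ^- r <= expR (g * m)], while [s + 1/2 <= 1 - g <= expR (- g)]. Together they
    even give [beta / 2]. *)
Lemma sample_size_bound (R : realType) (k : subgaussian_kind) (m r : nat) (beta : R) :
  0 < beta < 1 ->
  (ln (2 / beta) + r%:R * ln (12 / (99 / 100)))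
    / subgaussian_gamma k (99 / 100 / 2) <= m%:R ->
  (99 / 100 / 12) ^- r * (99 / 100 / 12 + 2^-1) ^+ m <= beta.
Proof.
move=> /andP[b0 b1]; have /andP[] := subgaussian_gamma_bound R k.
set g := subgaussian_gamma _ _ => g0 g5; rewrite ler_pdivrMr// => mg.
set s : R := 99 / 100 / 12.
have s0 : 0 < s by rewrite /s; lra.
have sE : 12 / (99 / 100) = s^-1 by rewrite /s; lra.
have sL : s^-1 = expR (ln (12 / (99 / 100))).
  by rewrite lnK ?sE// posrE invr_gt0.
have bL : 2 / beta = expR (ln (2 / beta)) by rewrite lnK// posrE divr_gt0.
have q : s + 2^-1 <= expR (- g).
  by apply: le_trans (expR_ge1Dx _); rewrite /s; lra.
have qm : (s + 2^-1) ^+ m <= (2 / beta)^-1 * s ^+ r.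
  apply: (@le_trans _ _ (expR (- g) ^+ m)).
    by apply: lerXn2r q; rewrite nnegrE ?expR_ge0// /s; lra.
  rewrite -expRM_natl mulrN expRN -[leRHS]invrK invfM invrK lef_pV2 ?posrE ?expR_gt0//.
    by rewrite -exprVn sL bL -expRM_natl -expRD ler_expR.
  by rewrite mulr_gt0 ?invr_gt0 ?exprn_gt0 ?divr_gt0.
apply: (@le_trans _ _ (s ^- r * ((2 / beta)^-1 * s ^+ r))).
  by rewrite ler_pM2l// invr_gt0 exprn_gt0.
rewrite mulrCA mulVf ?mulr1 ?expf_neq0 ?gt_eqF// invf_div; lra.
Qed.

(** * Uniqueness of the minimizer, and the probability bound *)

Lemma fullrank_unique_minimizer (R : realType) (m n : nat) (A : 'M[R]_(m, n))
    (W : 'M[R]_n) (xi : 'cV[R]_n) :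
  mxrange W xi -> (\rank W <= \rank (A *m W))%N ->
  unique_minimizer (objective W) (feasible A W xi) xi.
Proof.
move=> Wxi rkAW; split=> [//|y [AyAxi [u _ Wu]] yxi].
have [v _ Wv] := Wxi; exfalso; apply: yxi.
have /mulmx_rank_injP inj : \rank (A *m W) = \rank W.
  by apply/eqP; rewrite eqn_leq mxrankM_maxr.
(* The difference [y - xi] is [W *m (u - v)], and [A] annihilates it. *)
apply/eqP; rewrite -subr_eq0 -Wu -Wv -mulmxBr; apply/eqP/inj.
by rewrite mulmxBr Wu Wv mulmxBr AyAxi subrr.
Qed.

Theorem theorem2p5 (R : realType) (d : measure_display) (T : measurableType d)
    (P : probability T R) (k : subgaussian_kind) (m n : nat)
    (A : {RV P >-> 'M[R]_(m, n)}) (W : {RV P >-> 'M[R]_n})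
    (xi : 'cV[R]_n) (beta : R) :
  (0 < m)%N -> (0 < n)%N ->
  subgaussian_matrix k A ->
  independent_rv P A W ->
  {ae P, forall w, symmetric_mx (W w) /\
                   forall a, eigenvalue (W w) a -> 0 <= a <= 1} ->
  {ae P, forall w, mxrange (W w) xi} ->
  0 < beta < 1 ->
  {ae P, forall w,
     (ln (2 / beta) + (\rank (W w))%:R * ln (12 / (99 / 100)))
       / subgaussian_gamma k (99 / 100 / 2) <= m%:R} ->
  with_probability_at_least P (1 - beta)
    [set w | unique_minimizer (objective (W w)) (feasible (A w) (W w) xi) xi].
Proof.
move=> m0 _ [A_indep A_law] AW _ [N1 [mN1 PN1 rangeN1]] beta01 [N2 [mN2 PN2 boundN2]].
pose bound (r : nat) := (ln (2 / beta) + r%:R * ln (12 / (99 / 100)))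
  / subgaussian_gamma k (99 / 100 / 2) <= m%:R.
(* The sample size condition is part of [E], so that the section at every [w] is small: it is empty
   where the condition fails. [W] comes first because the conditioning is on [W]. *)
pose E : set ('M[R]_n * 'M[R]_(m, n)) :=
  [set WA | (\rank (WA.2 *m WA.1) < \rank WA.1)%N /\ bound (\rank WA.1)].
have mE : measurable E.
  rewrite (_ : E = [set WA | (\rank (WA.2 *m WA.1) < \rank WA.1)%N] `&`
     (fun WA : 'M[R]_n * 'M[R]_(m, n) => \rank WA.1) @^-1` bound) //.
  apply: measurableI.
    apply: measurable_rank_lt; last exact: measurable_fst.
    by apply: measurable_mulmx; [exact: measurable_snd|exact: measurable_fst].
  rewrite -[X in measurable X]setTI.
  by apply: (measurableT_comp (measurable_rank n n) measurable_fst).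
have PE : (P ((fun w => (W w, A w)) @^-1` E) <= beta%:E)%E.
  apply: independent_rv_le => // w.
  have [bw|bw] := boolP (bound (\rank w)); last first.
    rewrite (_ : xsection E w = set0) ?measure0 ?lee_fin; first by lra.
    by apply/seteqP; split => // a; rewrite /xsection/= inE => -[_ /(negP bw)].
  rewrite (_ : xsection E w = [set a | (\rank (a *m w) < \rank w)%N]); last first.
    by apply/seteqP; split => a; rewrite /xsection/= inE; [case|split].
  apply: le_trans (rank_mul_measure_le (distribution P A) _ _ n w (99 / 100 / 12) _) _.
  - exact: A_indep.
  - move=> i j c; apply: (entry_law_atom_le R _ _ P k m (fun w => A w i j)) => //.
    exact: (measurableT_comp (measurable_entry i j)).
  - by apply/andP; split; lra.
  - by rewrite lee_fin (sample_size_bound R k).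
(* [N1] and [N2] are measurable null sets containing the failures of the range and sample size
   conditions; the complement of [bad] is the measurable witness for the inner probability. *)
pose bad := N1 `|` N2 `|` (fun w => (W w, A w)) @^-1` E.
have mbad : measurable bad.
  apply: measurableU; first exact: measurableU.
  rewrite -[X in measurable X]setTI.
  by apply: (@measurable_fun_pair _ _ _ _ _ _ W A).
exists (~` bad); split; first exact: measurableC.
- move=> w /not_orP[/not_orP[N1w N2w] Ew].
  apply: fullrank_unique_minimizer.
    by apply: contrapT => /(rangeN1 w).
  rewrite leqNgt; apply/negP => rk; apply: Ew; split => //=.
  by apply: contrapT => /(boundN2 w).
- rewrite probability_setC// EFinB leeB//.
  have PN12 : P (N1 `|` N2) = 0%E by rewrite measureU0.
  rewrite /bad setUC measureU0//; last exact: measurableU.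
  by rewrite -[X in measurable X]setTI; exact: measurable_fun_pair.
Qed.
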